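(* Let $q$ be a prime power and let $L$ be a line of $\mathrm{PG}(5,q)$ in the $K$-orbit $o_{8,1}$. Then the hyperplane-orbit distribution $OD_4(L)$ is $\left[1,\,q^2+\frac32q,\,\frac q2,\,q^3-q\right]$ if $q$ is even, and $\left[2,\,q^2+\frac{3q-1}{2},\,\frac{q-1}{2},\,q^3-q\right]$ if $q$ is odd.
   Context: A point $(y_0,\dots,y_5)$ of $\mathrm{PG}(5,q)$ is identified with the nonzero symmetric matrix $\begin{bmatrix} y_0&y_1&y_2\\ y_1&y_3&y_4\\ y_2&y_4&y_5\end{bmatrix}$ up to scalar. $K\cong\mathrm{PGL}(3,q)$ acts by $M\mapsto AMA^T$, $A\in\mathrm{GL}(3,q)$. The orbit $o_{8,1}$ is the $K$-orbit of the line $\left\{\begin{bmatrix}x&0&0\\0&y&0\\0&0&-y\end{bmatrix}:(x,y)\in\mathrm{PG}(1,q)\right\}$. Hyperplanes correspond to conics of $\mathrm{PG}(2,q)$ (nonzero quadratic forms up to scalar): $\sum_{0\le i\le j\le2}a_{ij}X_iX_j$ corresponds to $a_{00}Y_0+a_{01}Y_1+a_{02}Y_2+a_{11}Y_3+a_{12}Y_4+a_{22}Y_5=0$. $\mathcal H_1,\mathcal H_{2,r},\mathcal H_{2,i},\mathcal H_3$ are the sets of hyperplanes corresponding respectively to double lines (scalar multiples of squares of linear forms), pairs of distinct real lines (products of two non-proportional linear forms over $\mathbb F_q$), pairs of conjugate imaginary lines (scalar multiples of products of two non-proportional linear forms conjugate over $\mathbb F_{q^2}$), and non-singular conics (those with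 $4a_{00}a_{11}a_{22}+a_{01}a_{02}a_{12}-a_{00}a_{12}^2-a_{11}a_{02}^2-a_{22}a_{01}^2\ne0$). $OD_4(L)=[h_1,h_{2,r},h_{2,i},h_3]$ lists the numbers of hyperplanes in $\mathcal H_1,\mathcal H_{2,r},\mathcal H_{2,i},\mathcal H_3$ containing $L$. *)

(* Defs.v *)
From HB Require Import structures.
From mathcomp Require Import all_boot all_order all_algebra.

Set Implicit Arguments.
Unset Strict Implicit.
Unset Printing Implicit Defensive.

Import GRing.Theory.
Local Open Scope ring_scope.

(* The vector (y_0, ..., y_5) is represented by its symmetric matrix M, so that
   y_0 = M 0 0, y_1 = M 0 1, y_2 = M 0 2, y_3 = M 1 1, y_4 = M 1 2,
   y_5 = M 2 2.  A point of PG(5,q) is a class of nonzero symmetric matrices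
   modulo nonzero scalars; lines and hyperplanes are sets of points. *)
Notation point F := {set 'M[F]_3}.

Section Geometry.
Variable F : finFieldType.

Definition pt (M : 'M[F]_3) : point F := [set c *: M | c : F & c != 0].

Definition PG5 : {set point F} :=
  [set pt M | M : 'M[F]_3 & (M^T == M) && (M != 0)].

Definition act_point (A : 'M[F]_3) (P : point F) : point F :=
  [set A *m M *m A^T | M in P].

Definition act_line (A : 'M[F]_3) (L : {set point F}) : {set point F} :=
  [set act_point A P | P in L].

Definition rep81 (x y : F) : 'M[F]_3 :=
  diag_mx (\row_(j < 3) [:: x; y; - y]`_j).

Definition line81 : {set point F} :=
  [set pt (rep81 u.1 u.2) | u : F * F & u != (0, 0)].

Definition o81 : {set {set point F}} :=
  [set act_line A line81 | A : 'M[F]_3 & A \in unitmx].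

End Geometry.

(* The quadratic form \sum_(i <= j) a_ij X_i X_j is represented by the upper
   triangular matrix of its coefficients a_ij, the linear form
   \sum_i l_i X_i by the row vector l. *)
Section Forms.
Variable R : fieldType.

Definition is_qform (a : 'M[R]_3) : bool := is_trig_mx a^T.

(* Coefficients of (\sum_i l_i X_i) * (\sum_j m_j X_j). *)
Definition lin_mul (l m : 'rV[R]_3) : 'M[R]_3 :=
  \matrix_(i, j) if i == j then l 0 i * m 0 i
                 else if (i < j)%N then l 0 i * m 0 j + l 0 j * m 0 i
                 else 0.

Definition non_proportional (l m : 'rV[R]_3) : bool := row_free (col_mx l m).

Definition qdisc (a : 'M[R]_3) : R :=
  4 * a 0 0 * a 1 1 * a 2 2 + a 0 1 * a 0 2 * a 1 2
  - a 0 0 * a 1 2 ^+ 2 - a 1 1 * a 0 2 ^+ 2 - a 2 2 * a 0 1 ^+ 2.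

End Forms.

(* Fq2 with the embedding iota is a model of the quadratic extension of F when
   #|Fq2| = #|F| ^ 2; conjugation over F is then x |-> x ^+ #|F|. *)
Section Conics.
Variables (F Fq2 : finFieldType) (iota : {rmorphism F -> Fq2}).
Implicit Types (a : 'M[F]_3) (l m : 'rV[F]_3).

Definition conj_form (l : 'rV[Fq2]_3) : 'rV[Fq2]_3 :=
  map_mx (fun x => x ^+ #|F|) l.

Definition double_line a : bool :=
  [exists c : F, exists l : 'rV[F]_3,
    [&& c != 0, l != 0 & a == c *: lin_mul l l]].

Definition real_line_pair a : bool :=
  [exists l : 'rV[F]_3, exists m : 'rV[F]_3,
    non_proportional l m && (a == lin_mul l m)].

Definition imaginary_line_pair a : bool :=
  [exists c : F, exists l : 'rV[Fq2]_3,
    [&& c != 0, non_proportional l (conj_form l)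
      & map_mx iota a == iota c *: lin_mul l (conj_form l)]].

Definition nonsingular_conic a : bool := qdisc a != 0.

Definition hyperplane a : {set point F} :=
  [set P in PG5 F | [forall M in P,
    \sum_(i < 3) \sum_(j < 3 | (i <= j)%N) a i j * (M : 'M[F]_3) i j == 0]].

Definition hyperplanes_of (C : pred 'M[F]_3) : {set {set point F}} :=
  [set hyperplane a | a : 'M[F]_3 & [&& is_qform a, a != 0 & C a]].

Definition H1 := hyperplanes_of double_line.
Definition H2r := hyperplanes_of real_line_pair.
Definition H2i := hyperplanes_of imaginary_line_pair.
Definition H3 := hyperplanes_of nonsingular_conic.

Definition OD4 (L : {set point F}) : seq nat :=
  [seq #|[set H in Hs | L \subset H]|
     | Hs : {set {set point F}} <- [:: H1; H2r; H2i; H3]].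

End Conics.

(* Main.v *)
Require Import Defs.
From HB Require Import structures.
From mathcomp Require Import all_boot all_order all_algebra.
From mathcomp Require Import all_fingroup all_solvable all_field.
From mathcomp Require Import ring zify.

Set Implicit Arguments.
Unset Strict Implicit.
Unset Printing Implicit Defensive.

Import GRing.Theory.
Local Open Scope ring_scope.

(* Substituting a matrix A in a quadratic form is dual to the congruence
   M |-> A M A^T and preserves each class of conics, so one may take for L the
   representative line.  The forms vanishing there are
   X (u Y + v Z) + b (Y^2 + Z^2) + c Y Z, and hyperplanes are counted by dividing
   a number of nonzero forms by q - 1.  The discriminant is u v c - b (u^2 + v^2).
   If it vanishes with (u, v) != 0 then u Y + v Z divides the form, which is a
   pair of real lines.  If u = v = 0 and b != 0 the form is b (Y^2 + s Y Z + Z^2):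
   a double line for s = 2 or s = -2, a pair of real lines for the other
   s = x + 1/x, and a pair of imaginary lines for the remaining s.  The involution
   x |-> 1/x, with fixed points 1 and -1, counts the values x + 1/x. *)

Lemma ord3P (P : 'I_3 -> Prop) : P 0 -> P 1 -> P 2 -> forall i, P i.
Proof.
move=> P0 P1 P2 [[|[|[|//]]] lti].
- by rewrite (_ : Ordinal lti = 0) //; apply: val_inj.
- by rewrite (_ : Ordinal lti = 1) //; apply: val_inj.
- by rewrite (_ : Ordinal lti = 2) //; apply: val_inj.
Qed.

Lemma sum_ord3 (V : nmodType) (f : 'I_3 -> V) :
  \sum_i f i = f 0 + f 1 + f 2.
Proof.
rewrite !big_ord_recr big_ord0 /= add0r.
by congr (f _ + f _ + f _); apply: val_inj.
Qed.

(** * Quadratic forms, substitutions and the trace pairing *)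

Section QuadraticForms.
Variable R : fieldType.
Implicit Types (a b A B M : 'M[R]_3) (l m : 'rV[R]_3).

(* The quadratic form x |-> x B x^T, i.e. B modulo alternating matrices. *)
Definition qform_of B : 'M[R]_3 :=
  \matrix_(i, j) if i == j then B i i
                 else if (i < j)%N then B i j + B j i else 0.

(** The form x |-> a(x A^T), brought back to triangular coefficients; on a linear form it acts as l
    |-> l A. *)
Definition subst_form A a := qform_of (A^T *m a *m A).

Lemma qform_of_is_qform B : is_qform (qform_of B).
Proof.
apply/is_trig_mxP => i j ltij; rewrite !mxE.
by rewrite -val_eqE gtn_eqF // ltnNge (ltnW ltij).
Qed.

Lemma qform_lower a (i j : 'I_3) : is_qform a -> (j < i)%N -> a i j = 0.
Proof. by move=> /is_trig_mxP qa /qa; rewrite mxE. Qed.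

(** Normalising B adds an alternating matrix, which is orthogonal to symmetric matrices in every
    characteristic. *)
Lemma mxtrace_qform_of B M : M^T = M -> \tr (qform_of B *m M) = \tr (B *m M).
Proof.
move=> symM; have symE i j : M i j = M j i by rewrite -{1}symM mxE.
rewrite /mxtrace !sum_ord3 !mxE !sum_ord3 !mxE /=.
by rewrite (symE 1 0) (symE 2 0) (symE 2 1); ring.
Qed.

(** The matrices E_ii and E_ij + E_ji each read off one coefficient, even in characteristic 2.
    Identities between forms thus reduce to cyclicity of the trace. *)
Lemma qform_eq a b : is_qform a -> is_qform b ->
  (forall M, M^T = M -> \tr (a *m M) = \tr (b *m M)) -> a = b.
Proof.
move=> qa qb eqab; apply/matrixP => i j.
have [ltji|leij] := ltnP j i; first by rewrite !qform_lower.
have tr_delta c k r : \tr (c *m delta_mx k r) = c r k :> R.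
  rewrite mxtrace_mulC /mxtrace (bigD1 k) //= big1 => [|s neq_sk].
    rewrite !mxE (bigD1 r) //= big1 => [|s neq_sr].
      by rewrite !mxE !eqxx mul1r !addr0.
    by rewrite !mxE (negPf neq_sr) andbF mul0r.
  rewrite !mxE big1 // => r' _.
  by rewrite !mxE (negPf neq_sk) mul0r.
have [->|neq_ij] := eqVneq i j.
  by rewrite -!tr_delta eqab // trmx_delta.
have ltij : (i < j)%N by rewrite ltn_neqAle neq_ij.
have := eqab (delta_mx i j + delta_mx j i).
rewrite !mulmxDr !linearD /= !trmx_delta !tr_delta addrC.
rewrite (qform_lower qa ltij) (qform_lower qb ltij) !add0r.
by apply.
Qed.

Lemma qform_ofK a : is_qform a -> qform_of a = a.
Proof.
move=> qa; apply: qform_eq => //; first exact: qform_of_is_qform.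
by move=> M /mxtrace_qform_of->.
Qed.

(** Substitution is the adjoint of congruence for the trace pairing; this transports incidence with
    a hyperplane along the action on points. *)
Lemma mxtrace_subst_form A a M : M^T = M ->
  \tr (subst_form A a *m M) = \tr (a *m (A *m M *m A^T)).
Proof.
move=> symM; rewrite mxtrace_qform_of // -!mulmxA mxtrace_mulC.
by rewrite !mulmxA.
Qed.

Lemma congr_sym A M : M^T = M -> (A *m M *m A^T)^T = A *m M *m A^T.
Proof. by move=> symM; rewrite !trmx_mul trmxK symM mulmxA. Qed.

Lemma subst_form_comp A B a :
  subst_form B (subst_form A a) = subst_form (A *m B) a.
Proof.
apply: qform_eq; try exact: qform_of_is_qform.
move=> M symM; rewrite !mxtrace_subst_form //; last exact: congr_sym.
by rewrite trmx_mul !mulmxA.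
Qed.

Lemma subst_form1 a : is_qform a -> subst_form 1%:M a = a.
Proof. by rewrite /subst_form trmx1 mul1mx mulmx1 => /qform_ofK. Qed.

Lemma subst_formK A a : A \in unitmx -> is_qform a ->
  subst_form (invmx A) (subst_form A a) = a.
Proof. by move=> uA qa; rewrite subst_form_comp mulmxV // subst_form1. Qed.

Lemma qform_ofZ c B : qform_of (c *: B) = c *: qform_of B.
Proof.
apply/matrixP => i j; rewrite !mxE.
by case: ifP => // _; case: ifP => _; rewrite ?mulrDr ?mulr0.
Qed.

Lemma subst_formZ A c a : subst_form A (c *: a) = c *: subst_form A a.
Proof. by rewrite /subst_form -qform_ofZ -scalemxAr -scalemxAl. Qed.

Lemma subst_form0 A : subst_form A 0 = 0.
Proof. by rewrite -(scale0r 0) subst_formZ !scale0r. Qed.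

Lemma subst_form_eq0 A a : A \in unitmx -> is_qform a ->
  (subst_form A a == 0) = (a == 0).
Proof.
move=> uA qa; apply/eqP/eqP => [s0|->]; last exact: subst_form0.
by rewrite -(subst_formK uA qa) s0 subst_form0.
Qed.

Lemma lin_mulE l m : lin_mul l m = qform_of (l^T *m m).
Proof.
apply/matrixP => i j; rewrite !mxE !big_ord1 !mxE.
by case: ifP => // _; rewrite [l 0 j * _]mulrC.
Qed.

Lemma lin_mul_is_qform l m : is_qform (lin_mul l m).
Proof. by rewrite lin_mulE qform_of_is_qform. Qed.

Lemma lin_mulC l m : lin_mul l m = lin_mul m l.
Proof.
apply/matrixP => i j; rewrite !mxE.
case: ifP => _; first by rewrite mulrC.
by case: ifP => // _; rewrite addrC; congr (_ + _); rewrite mulrC.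
Qed.

Lemma lin_mulZl c l m : lin_mul (c *: l) m = c *: lin_mul l m.
Proof. by rewrite !lin_mulE linearZ -scalemxAl qform_ofZ. Qed.

Lemma subst_lin_mul A l m :
  subst_form A (lin_mul l m) = lin_mul (l *m A) (m *m A).
Proof.
rewrite !lin_mulE; apply: qform_eq; try exact: qform_of_is_qform.
move=> M symM; rewrite mxtrace_subst_form //.
rewrite !mxtrace_qform_of //; last exact: congr_sym.
by rewrite trmx_mul mulmxA mxtrace_mulC !mulmxA.
Qed.

Lemma non_proportionalP l m :
  reflect (exists i, exists j, l 0 i * m 0 j != l 0 j * m 0 i)
          (non_proportional l m).
Proof.
apply: (iffP idP) => [nlm | [i [j minor]]]; last first.
  apply: inj_row_free => v.
  rewrite -[v]hsubmxK mul_row_col [lsubmx v]mx11_scalar [rsubmx v]mx11_scalar.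
  rewrite !mul_scalar_mx; move: (lsubmx v 0 0) (rsubmx v 0 0) => x y eq0.
  have /rowP/(_ i) := eq0; rewrite !mxE => eqi.
  have /rowP/(_ j) := eq0; rewrite !mxE => eqj.
  (* Cramer's rule: combining columns i and j multiplies each unknown by the nonzero minor. *)
  have x0 : x = 0.
    apply/eqP; have /eqP : x * (l 0 i * m 0 j - l 0 j * m 0 i) = 0.
      transitivity (m 0 j * (x * l 0 i + y * m 0 i)
                    - m 0 i * (x * l 0 j + y * m 0 j)); first by ring.
      by rewrite eqi eqj; ring.
    by rewrite mulf_eq0 subr_eq0 (negPf minor) orbF.
  have y0 : y = 0.
    apply/eqP; have /eqP : y * (l 0 i * m 0 j - l 0 j * m 0 i) = 0.
      transitivity (l 0 i * (x * l 0 j + y * m 0 j)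
                    - l 0 j * (x * l 0 i + y * m 0 i)); first by ring.
      by rewrite eqi eqj; ring.
    by rewrite mulf_eq0 subr_eq0 (negPf minor) orbF.
  by rewrite x0 y0 raddf0 row_mx0.
have ker0 x y : x *: l + y *: m = 0 -> x = 0 /\ y = 0.
  move=> eq0; have: row_mx x%:M y%:M *m col_mx l m = 0.
    by rewrite mul_row_col !mul_scalar_mx.
  move/(canRL (mulmxKp nlm)); rewrite mul0mx -(row_mx0 _ 1 1 1) => /eq_row_mx.
  by move=> -[/matrixP/(_ 0 0) + /matrixP/(_ 0 0)];
    rewrite !mxE /= !mulr1n.
have [l0|/rV0Pn[i nzli]] := eqVneq l 0.
  have [] := ker0 1 0; first by rewrite l0 scaler0 scale0r addr0.
  by move/eqP; rewrite oner_eq0.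
suff /existsP[j] : [exists j, l 0 i * m 0 j != l 0 j * m 0 i] by exists i, j.
apply: contraNT nzli; rewrite negb_exists => /forallP all0.
(* If all minors through column i vanish, then -m_i l + l_i m = 0 is a relation, and independence
   forces l_i = 0. *)
have [|_ ->//] := ker0 (- m 0 i) (l 0 i).
apply/rowP => j; rewrite !mxE; have := all0 j; rewrite negbK => /eqP->.
by ring.
Qed.

(** The discriminant is multiplied by det(A)^2, expanded below. Applied to the inverse of A, this
    shows that invertible substitutions preserve nonsingularity. *)
Lemma qdisc_subst_eq0 A a : is_qform a -> qdisc a = 0 ->
  qdisc (subst_form A a) = 0.
Proof.
move=> qa a0.
transitivity ((A 0 0 * (A 1 1 * A 2 2 - A 1 2 * A 2 1)
  - A 0 1 * (A 1 0 * A 2 2 - A 1 2 * A 2 0)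
  + A 0 2 * (A 1 0 * A 2 1 - A 1 1 * A 2 0)) ^+ 2 * qdisc a); last first.
  by rewrite a0 mulr0.
rewrite /qdisc /subst_form !mxE /= !sum_ord3 !mxE !sum_ord3 !mxE.
rewrite (@qform_lower a 1 0) // (@qform_lower a 2 0) // (@qform_lower a 2 1) //.
ring.
Qed.

End QuadraticForms.

Lemma card_imset_fibers (T U : finType) (f : T -> U) (S : {set T}) k :
    (forall x, x \in S -> #|[set y in S | f y == f x]| = k) ->
  #|S| = (#|f @: S| * k)%N.
Proof.
move=> card_fiber; rewrite -sum1_card (partition_big_imset f) /=.
rewrite -sum_nat_const; apply: eq_bigr => _ /imsetP[x Sx ->].
by rewrite -(card_fiber x Sx) -sum1dep_card.
Qed.

(** * Hyperplanes through a line of the orbit *)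

Section Hyperplanes.
Variable F : finFieldType.
Implicit Types (a b A M N : 'M[F]_3) (t : (F * F) * (F * F)).

Lemma is_qformZ (K : fieldType) (c : K) (a : 'M[K]_3) :
  is_qform a -> is_qform (c *: a).
Proof.
by move=> /is_trig_mxP qa; apply/is_trig_mxP => i j /qa;
  rewrite !mxE => ->; rewrite mulr0.
Qed.

Lemma mxtrace_qform a M : is_qform a -> M^T = M ->
  \sum_(i < 3) \sum_(j < 3 | (i <= j)%N) a i j * M i j = \tr (a *m M).
Proof.
move=> qa symM; apply: eq_bigr => i _.
rewrite mxE big_mkcond /=; apply: eq_bigr => j _.
have -> : M j i = M i j by rewrite -{1}symM mxE.
by case: leqP => // ltji; rewrite qform_lower ?mul0r.
Qed.

Lemma act_point_pt A M : act_point A (pt M) = pt (A *m M *m A^T).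
Proof.
apply/setP => N; apply/imsetP/imsetP => [[_ /imsetP[c nzc ->] ->]|[c nzc ->]].
  by exists c => //; rewrite -scalemxAr -scalemxAl.
by exists (c *: M); [apply: imset_f | rewrite -scalemxAr -scalemxAl].
Qed.

Lemma mem_hyperplane a M : is_qform a -> M^T = M -> M != 0 ->
  (pt M \in hyperplane a) = (\tr (a *m M) == 0).
Proof.
move=> qa symM nzM; rewrite inE imset_f ?inE ?symM ?eqxx //=.
apply/forall_inP/idP => [/(_ M)|trM _ /imsetP[c nzc ->]].
  rewrite mxtrace_qform //; apply.
  by apply/imsetP; exists 1; rewrite ?scale1r // inE oner_eq0.
rewrite mxtrace_qform //; last by rewrite linearZ /= symM.
by rewrite -scalemxAr linearZ /= (eqP trM) mulr0.
Qed.

Lemma hyperplaneZ c a : is_qform a -> c != 0 ->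
  hyperplane (c *: a) = hyperplane a.
Proof.
move=> qa nzc; apply/setP => P.
have [/imsetP[M + ->]|notP] := boolP (P \in PG5 F); last first.
  by rewrite !inE (negPf notP).
rewrite inE => /andP[/eqP symM nzM].
rewrite !mem_hyperplane ?is_qformZ // -scalemxAl linearZ /=.
by rewrite mulf_eq0 (negPf nzc).
Qed.

(** Two nonzero linear functionals on symmetric matrices with the same kernel are proportional; the
    ratio is read at a matrix N outside the kernel. *)
Lemma hyperplane_inj a b : is_qform a -> is_qform b -> a != 0 -> b != 0 ->
  hyperplane b = hyperplane a -> exists2 c, c != 0 & b = c *: a.
Proof.
move=> qa qb nza nzb eqba.
have ker_ab M : M^T = M -> \tr (a *m M) = 0 -> \tr (b *m M) = 0.
  have [->|nzM symM /eqP aM0] := eqVneq M 0; first by rewrite !mulmx0 !raddf0.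
  by apply/eqP; rewrite -mem_hyperplane // eqba mem_hyperplane.
have /existsP[N /andP[/eqP symN nzaN]] :
    [exists N, (N^T == N) && (\tr (a *m N) != 0)].
  apply: contraNT nza; rewrite negb_exists => /forallP ker_a.
  apply/eqP/qform_eq => // [|M symM].
    by apply/is_trig_mxP => i j _; rewrite !mxE.
  have := ker_a M; rewrite symM eqxx negbK => /eqP->.
  by rewrite mul0mx raddf0.
have def_b : b = (\tr (b *m N) / \tr (a *m N)) *: a.
  apply: qform_eq => // [|M symM]; first exact: is_qformZ.
  (* This multiple of N is subtracted so that the difference lies in the kernel of a, hence in that
     of b. *)
  have := ker_ab (M - (\tr (a *m M) / \tr (a *m N)) *: N).
  rewrite !mulmxBr -!scalemxAr !linearB !linearZ /= symM symN divfK // subrr.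
  move=> /(_ erefl erefl)/eqP; rewrite subr_eq0 => /eqP->.
  by rewrite -scalemxAl linearZ /= mulrAC [RHS]mulrAC [X in X / _]mulrC.
exists (\tr (b *m N) / \tr (a *m N)) => //.
by apply: contraNneq nzb => c0; rewrite def_b c0 scale0r.
Qed.

(** By adjointness the condition says that [subst_form A a] pairs to zero with every diag(x, y, -y),
    and this pairing is linear in x and y. *)
Lemma sub_hyperplane A a : A \in unitmx -> is_qform a ->
  (act_line A (line81 F) \subset hyperplane a) =
  (subst_form A a 0 0 == 0) && (subst_form A a 1 1 == subst_form A a 2 2).
Proof.
move=> uA qa; set g := subst_form A a.
have sym81 (x y : F) : (rep81 x y)^T = rep81 x y by exact: tr_diag_mx.
have trg (x y : F) : \tr (g *m rep81 x y) = g 0 0 * x + (g 1 1 - g 2 2) * y.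
  rewrite mul_mx_diag /mxtrace sum_ord3 !mxE /=; ring.
have in_a (x y : F) : (x, y) != (0, 0) ->
    (act_point A (pt (rep81 x y)) \in hyperplane a)
      = (g 0 0 * x + (g 1 1 - g 2 2) * y == 0).
  move=> nz_xy; rewrite act_point_pt mem_hyperplane ?congr_sym //.
    by rewrite -mxtrace_subst_form // trg.
  have nz81 : rep81 x y != 0.
    apply: contraNneq nz_xy => /matrixP r0.
    by have := r0 0 0; have := r0 1 1; rewrite !mxE /= !mulr1n => -> ->.
  apply: contraNneq nz81 => r0; rewrite -(mulKmx uA (rep81 x y)).
  have uAT : A^T \in unitmx by rewrite unitmx_tr.
  rewrite -[A *m _](mulmxK uAT) r0.
  by rewrite mul0mx mulmx0.
apply/subsetP/andP => [sub|].
  have xy0 (x y : F) : (x, y) != (0, 0) -> g 0 0 * x + (g 1 1 - g 2 2) * y == 0.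
    move=> nz_xy; rewrite -in_a //; apply: sub; apply: imset_f.
    by apply/imsetP; exists (x, y); rewrite ?inE.
  (* The two spanning points (1, 0) and (0, 1) give the two equations. *)
  have := xy0 1 0; have := xy0 0 1.
  rewrite !xpair_eqE oner_eq0 andbF /= => /(_ isT) + /(_ isT).
  by rewrite !(mulr0, mulr1, add0r, addr0) subr_eq0.
case=> /eqP g0 /eqP g12 _ /imsetP[_ /imsetP[[x y] + ->] ->].
by rewrite inE => nz_xy; rewrite in_a // g0 g12 subrr !mul0r addr0.
Qed.

(* The form X (u Y + v Z) + b (Y^2 + Z^2) + c Y Z with t = ((u, v), (b, c)):
   these are the forms whose hyperplane contains the representative line. *)
Definition form81 t : 'M[F]_3 :=
  \matrix_(i < 3, j < 3)
    nth 0 (nth [::] [:: [:: 0; t.1.1; t.1.2]; [:: 0; t.2.1; t.2.2];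
                        [:: 0; 0; t.2.1]] i) j.

Lemma form81_is_qform t : is_qform (form81 t).
Proof.
by apply/is_trig_mxP; elim/ord3P; elim/ord3P => //= _; rewrite !mxE.
Qed.

Lemma form81_inj : injective form81.
Proof.
move=> [[u v] [b c]] [[u' v'] [b' c']] /matrixP eq_t.
have := eq_t 0 1; have := eq_t 0 2; have := eq_t 1 1; have := eq_t 1 2.
by rewrite !mxE /= => -> -> -> ->.
Qed.

Lemma form81_surj a : is_qform a -> a 0 0 = 0 -> a 1 1 = a 2 2 ->
  a = form81 ((a 0 1, a 0 2), (a 1 1, a 1 2)).
Proof.
move=> qa a0 a12; apply/matrixP.
by elim/ord3P; elim/ord3P; rewrite !mxE //= qform_lower.
Qed.

Lemma form81_eq0 t : (form81 t == 0) = (t == 0).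
Proof.
rewrite -(inj_eq form81_inj); congr (_ == _).
by apply/matrixP; elim/ord3P; elim/ord3P; rewrite !mxE.
Qed.

(** The forms of class C whose hyperplane contains the line make up [S]. Substituting the inverse of
    A maps the parameters t bijectively onto [S], and each hyperplane comes from the q - 1 nonzero
    multiples of one form. *)
Lemma card_hyperplanes_of (C : pred 'M[F]_3) A : A \in unitmx ->
    (forall c a, is_qform a -> c != 0 -> C a -> C (c *: a)) ->
    (forall A a, A \in unitmx -> is_qform a -> C a -> C (subst_form A a)) ->
  #|[set t : (F * F) * (F * F) | (t != 0) && C (form81 t)]| =
  (#|[set H in hyperplanes_of C | act_line A (line81 F) \subset H]| *
   #|F|.-1)%N.
Proof.
move=> uA CZ CA; set L := act_line _ _.
pose S := [set a | [&& is_qform a, a != 0, C a & L \subset hyperplane a]].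
have -> : [set H in hyperplanes_of C | L \subset H] = @hyperplane F @: S.
  apply/setP => H; rewrite inE; apply/andP/imsetP => [[]|[a]].
    move/imsetP=> [a]; rewrite inE => /and3P[qa nza Ca] -> sL.
    by exists a; rewrite // inE qa nza Ca.
  rewrite inE => /and4P[qa nza Ca sL] ->; split=> //.
  by apply: imset_f; rewrite inE qa nza.
rewrite -(card_imset_fibers (k := #|F|.-1)) => [|a].
  pose f t := subst_form (invmx A) (form81 t).
  have uA' : invmx A \in unitmx by rewrite unitmx_inv.
  have fK t : subst_form A (f t) = form81 t.
    by rewrite -[A in subst_form A]invmxK subst_formK ?form81_is_qform.
  have f_inj : injective f.
    by move=> t t' eq_f; apply: form81_inj; rewrite -!fK eq_f.
  rewrite -(card_imset _ f_inj); apply: eq_card => a.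
  apply/imsetP/idP => [[t] |].
    rewrite inE => /andP[nzt Ct] ->; rewrite inE qform_of_is_qform /=.
    rewrite subst_form_eq0 ?form81_is_qform // form81_eq0 nzt.
    rewrite CA ?form81_is_qform // sub_hyperplane // ?qform_of_is_qform //.
    by rewrite fK !mxE /= !eqxx.
  rewrite inE => /and4P[qa nza Ca].
  rewrite sub_hyperplane // => /andP[/eqP g0 /eqP g12].
  have qg : is_qform (subst_form A a) by exact: qform_of_is_qform.
  have def_g := form81_surj qg g0 g12; set t := (_, _) in def_g.
  exists t; last by rewrite /f -def_g subst_formK.
  by rewrite inE -form81_eq0 -def_g subst_form_eq0 // nza CA.
rewrite inE => /and4P[qa nza Ca sL].
have -> : #|F|.-1 = #|[set~ (0 : F)]| by rewrite cardsC1.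
rewrite -(card_imset (f := fun c => c *: a)) => [|c d /eqP]; last first.
  rewrite -subr_eq0 -scalerBl scaler_eq0 (negPf nza) orbF subr_eq0.
  exact: eqP.
apply: eq_card => b; rewrite !inE; apply/andP/imsetP.
  case=> /and4P[qb nzb Cb sLb] /eqP/hyperplane_inj[] // c nzc ->.
  by exists c; rewrite ?inE.
case=> c; rewrite !inE => nzc ->.
rewrite hyperplaneZ // is_qformZ // sL eqxx CZ // scaler_eq0 negb_or nzc.
by rewrite nza.
Qed.

End Hyperplanes.

(** * Finite fields and the Frobenius map *)

(** The additive group is elementary abelian, so its order is a power of the characteristic. *)
Lemma pnat_card_finField (F : finFieldType) : [pchar F].-nat #|F|.
Proof.
have [p _ pF] := finPcharP F.
have := abelem_pgroup (fin_ring_pchar_abelem pF).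
by rewrite /pgroup cardsT (eq_pnat _ (pcharf_eq pF)).
Qed.

Lemma odd_card_finField (F : finFieldType) : odd #|F| = (2 != 0 :> F).
Proof.
have qF := pnat_card_finField F.
have [p2 | p2] := eqVneq (2 : F) 0; apply/negP/negP.
  have ch2 : 2%N \in [pchar F] by rewrite inE /= p2 eqxx.
  move: qF; rewrite (eq_pnat _ (pcharf_eq ch2)) => /p_natP[[|k] q2].
    by have := finNzRing_gt1 F; rewrite q2.
  by rewrite q2 oddX.
apply: contraNT p2; rewrite -dvdn2 => dvd2q.
by have /andP[] := pnatP _ (ltnW (finNzRing_gt1 F)) qF 2%N isT dvd2q.
Qed.

(** Over E the polynomial X^#|E| - X is the product of all X - w, so its roots in K are exactly the
    images of the w. *)
Lemma root_card_finField (E : finFieldType) (K : fieldType)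
    (j : {rmorphism E -> K}) (z : K) :
  z ^+ #|E| = z -> exists w, z = j w.
Proof.
move=> zE; have: (map_poly j ('X^#|E| - 'X)).[z] = 0.
  by rewrite rmorphB /= map_polyXn map_polyX !hornerE zE subrr.
rewrite finField_genPoly rmorph_prod horner_prod => /eqP/prodf_eq0[w _].
by rewrite rmorphB /= map_polyX map_polyC !hornerE subr_eq0 => /eqP; exists w.
Qed.

(** The difference of the two sides is (x - y)(x - 1/y)/x. Hence the fibres of x + 1/x are the
    orbits of inversion. *)
Lemma addV_eq (K : fieldType) (x y : K) : x != 0 -> y != 0 ->
  (x + x^-1 == y + y^-1) = (x == y) || (x == y^-1).
Proof.
move=> nzx nzy; rewrite -subr_eq0.
have -> : x + x^-1 - (y + y^-1) = (x - y) * (x - y^-1) / x.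
  by field; rewrite nzx.
by rewrite !mulf_eq0 invr_eq0 (negPf nzx) orbF !subr_eq0.
Qed.

Section QuadraticExtension.
Variables (F Fq2 : finFieldType) (iota : {rmorphism F -> Fq2}).

(** The embedding [j] gives K the characteristic of F, and #|F| is a power of it. *)
Lemma frobD (K : fieldType) (j : {rmorphism F -> K}) (x y : K) :
  (x + y) ^+ #|F| = x ^+ #|F| + y ^+ #|F|.
Proof.
apply: exprDn_pchar; apply: sub_in_pnat (pnat_card_finField F) => p _.
exact: rmorph_pchar.
Qed.

Lemma frob_fix (K : fieldType) (j : {rmorphism F -> K}) x :
  j x ^+ #|F| = j x.
Proof. by rewrite -rmorphXn expf_card. Qed.

Lemma conj_form_mulmx l A :
  conj_form F (l *m map_mx iota A) =
  conj_form F l *m map_mx iota A :> 'rV[Fq2]_3.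
Proof.
apply/rowP => i; rewrite !mxE !sum_ord3 !mxE !(frobD iota) !exprMn.
by rewrite !(frob_fix iota).
Qed.

(* A root z of X^2 - s X + 1 in an algebraic closure of Fq2 is sent by
   Frobenius to z or z^-1, hence lies in Fq2. *)
Lemma norm1_addV (s : F) : #|Fq2| = (#|F| ^ 2)%N ->
  (forall t, t != 0 -> t + t^-1 != s) ->
  exists w : Fq2,
    [/\ w != 0, w ^+ #|F| = w^-1, w + w^-1 = iota s & w ^+ #|F| != w].
Proof.
move=> hFq2 no_root; have [K [j _]] := countable_algebraic_closure Fq2.
(* The coefficient list encodes z^2 = s z - 1. *)
have [|z] := @solve_monicpoly K 2 (nth 0 [:: -1; j (iota s)]); first by [].
rewrite !big_ord_recl big_ord0 /= expr0 expr1 addr0 mulr1 => eq_z.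
have nzz : z != 0.
  apply/eqP => z0; move/eqP: eq_z.
  by rewrite z0 expr0n mulr0 addr0 eq_sym oppr_eq0 oner_eq0.
have zV : z + z^-1 = j (iota s).
  apply: (mulIf nzz); rewrite mulrDl mulVf // -expr2 eq_z; ring.
have : z ^+ #|F| + (z ^+ #|F|)^-1 == z + z^-1.
  rewrite zV -exprVn -(frobD (j \o iota)) zV.
  by rewrite (frob_fix (j \o iota)).
rewrite addV_eq ?expf_neq0 // => zq.
have [w def_z] : exists w, z = j w.
  (* Both z^q = z and z^q = 1/z give z^(q^2) = z. *)
  apply: (root_card_finField j); rewrite hFq2 expnS expn1 exprM.
  case/orP: zq => /eqP zq; rewrite zq ?zq //.
  by rewrite exprVn zq invrK.
have nzw : w != 0 by rewrite -(fmorph_eq0 j) -def_z.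
have wV : w + w^-1 = iota s.
  by apply: (fmorph_inj j); rewrite rmorphD fmorphV -def_z.
(* Otherwise w comes from F and contradicts [no_root]; only w^q = 1/w is then left. *)
have wqn : w ^+ #|F| != w.
  apply/eqP => /(root_card_finField iota)[t def_w].
  have nzt : t != 0 by rewrite -(fmorph_eq0 iota) -def_w.
  have /eqP[] := no_root t nzt; apply: (fmorph_inj iota).
  by rewrite rmorphD fmorphV -def_w.
exists w; split=> //; apply: (fmorph_inj j).
case/orP: zq => /eqP; rewrite def_z -rmorphXn -?fmorphV //.
by move/(fmorph_inj j)/eqP; rewrite (negPf wqn).
Qed.

(** * Invariance of the four classes under scaling and substitution *)

Lemma non_proportionalZl (K : fieldType) (c : K) (l m : 'rV_3) : c != 0 ->
  non_proportional l m -> non_proportional (c *: l) m.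
Proof.
move=> nzc /non_proportionalP[i [k minor]]; apply/non_proportionalP.
by exists i, k; rewrite !mxE -!mulrA (inj_eq (mulfI nzc)).
Qed.

Lemma non_proportional_mulmx (K : fieldType) (A : 'M[K]_3) (l m : 'rV_3) :
  A \in unitmx -> non_proportional (l *m A) (m *m A) = non_proportional l m.
Proof.
move=> uA; rewrite /non_proportional -mul_col_mx /row_free.
by rewrite mxrankMfree // row_free_unit.
Qed.

Lemma mulmx_unit_eq0 (K : fieldType) (A : 'M[K]_3) (l : 'rV_3) :
  A \in unitmx -> (l *m A == 0) = (l == 0).
Proof.
move=> uA; apply/eqP/eqP => [lA|->]; last exact: mul0mx.
by rewrite -(mulmxK uA l) lA mul0mx.
Qed.

Lemma map_subst_form (A a : 'M[F]_3) :
  map_mx iota (subst_form A a) = subst_form (map_mx iota A) (map_mx iota a).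
Proof.
rewrite /subst_form map_trmx -!map_mxM; apply/matrixP => i j.
by rewrite !mxE; case: ifP => // _; case: ifP; rewrite ?rmorphD ?rmorph0.
Qed.

Implicit Types (a A : 'M[F]_3).

Lemma is_qform_map a : is_qform a -> is_qform (map_mx iota a).
Proof.
by move=> qa; apply/is_trig_mxP => i j ltij;
  rewrite !mxE (qform_lower qa ltij) rmorph0.
Qed.

Lemma double_lineZ c a : is_qform a -> c != 0 ->
  double_line a -> double_line (c *: a).
Proof.
move=> _ nzc /existsP[d /existsP[l /and3P[nzd nzl /eqP->]]].
apply/existsP; exists (c * d); apply/existsP; exists l.
by rewrite mulf_neq0 // nzl scalerA eqxx.
Qed.

Lemma double_line_subst A a : A \in unitmx -> is_qform a ->
  double_line a -> double_line (subst_form A a).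
Proof.
move=> uA _ /existsP[d /existsP[l /and3P[nzd nzl /eqP->]]].
apply/existsP; exists d; apply/existsP; exists (l *m A).
by rewrite nzd mulmx_unit_eq0 // nzl subst_formZ subst_lin_mul eqxx.
Qed.

Lemma real_line_pairZ c a : is_qform a -> c != 0 ->
  real_line_pair a -> real_line_pair (c *: a).
Proof.
move=> _ nzc /existsP[l /existsP[m /andP[nlm /eqP->]]].
apply/existsP; exists (c *: l); apply/existsP; exists m.
by rewrite non_proportionalZl // lin_mulZl eqxx.
Qed.

Lemma real_line_pair_subst A a : A \in unitmx -> is_qform a ->
  real_line_pair a -> real_line_pair (subst_form A a).
Proof.
move=> uA _ /existsP[l /existsP[m /andP[nlm /eqP->]]].
apply/existsP; exists (l *m A); apply/existsP; exists (m *m A).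
by rewrite non_proportional_mulmx // nlm subst_lin_mul eqxx.
Qed.

Lemma imaginary_line_pairZ c a : is_qform a -> c != 0 ->
  imaginary_line_pair iota a -> imaginary_line_pair iota (c *: a).
Proof.
move=> _ nzc /existsP[d /existsP[l /and3P[nzd nl /eqP def_a]]].
apply/existsP; exists (c * d); apply/existsP; exists l.
by rewrite mulf_neq0 // nl map_mxZ def_a scalerA -rmorphM eqxx.
Qed.

Lemma imaginary_line_pair_subst A a : A \in unitmx -> is_qform a ->
  imaginary_line_pair iota a -> imaginary_line_pair iota (subst_form A a).
Proof.
move=> uA _ /existsP[d /existsP[l /and3P[nzd nl /eqP def_a]]].
apply/existsP; exists d; apply/existsP; exists (l *m map_mx iota A).
rewrite nzd conj_form_mulmx non_proportional_mulmx ?map_unitmx // nl.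
by rewrite map_subst_form def_a subst_formZ subst_lin_mul eqxx.
Qed.

Lemma nonsingular_conicZ c a : is_qform a -> c != 0 ->
  nonsingular_conic a -> nonsingular_conic (c *: a).
Proof.
move=> _ nzc; rewrite /nonsingular_conic.
have -> : qdisc (c *: a) = c ^+ 3 * qdisc a by rewrite /qdisc !mxE; ring.
by move=> nza; rewrite mulf_neq0 // expf_neq0.
Qed.

Lemma nonsingular_conic_subst A a : A \in unitmx -> is_qform a ->
  nonsingular_conic a -> nonsingular_conic (subst_form A a).
Proof.
move=> uA qa; apply: contraNneq => /qdisc_subst_eq0 disc0.
by rewrite -(subst_formK uA qa) disc0 ?qform_of_is_qform.
Qed.

End QuadraticExtension.

Lemma qform_ext (R : fieldType) (a b : 'M[R]_3) : is_qform a -> is_qform b ->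
    a 0 0 = b 0 0 -> a 0 1 = b 0 1 -> a 0 2 = b 0 2 ->
    a 1 1 = b 1 1 -> a 1 2 = b 1 2 -> a 2 2 = b 2 2 ->
  a = b.
Proof.
move=> qa qb e00 e01 e02 e11 e12 e22; apply/matrixP.
by elim/ord3P; elim/ord3P; rewrite // !qform_lower.
Qed.

(** * Classification of the forms vanishing on the representative line *)

Section Classes.
Variable F : finFieldType.
Implicit Types (t : (F * F) * (F * F)) (B : {set F}).

Definition row3 (K : fieldType) (x y z : K) : 'rV_3 :=
  \row_(i < 3) nth 0 [:: x; y; z] i.

(** Under [form81] these are the forms b (Y^2 + s Y Z + Z^2) with b != 0 and s in B; the parameter s
    = c / b is unchanged by scaling. *)
Definition pencil B : {set (F * F) * (F * F)} :=
  [set ((0, 0), (x.1, x.1 * x.2)) | x in setX [set~ 0] B].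

Definition addV (x : F) := x + x^-1.
(* The s for which X^2 - s X + 1 has a root in F. *)
Definition trace1 : {set F} := addV @: [set~ 0].
(** The s for which X^2 - s X + 1 has two distinct roots in F, namely x and 1/x. *)
Definition split_trace1 : {set F} := addV @: [set x | (x != 0) && (x != x^-1)].

(* For (u, v) != 0 the discriminant is a nonzero linear form in (b, c), whose
   kernel is spanned by (u v, u^2 + v^2). *)
Definition degenerate81 : {set (F * F) * (F * F)} :=
  [set (x.1, (x.2 * (x.1.1 * x.1.2), x.2 * (x.1.1 ^+ 2 + x.1.2 ^+ 2)))
    | x in setX [set~ (0, 0)] [set: F]].

Lemma mem_pencil u v b c B :
  (((u, v), (b, c)) \in pencil B) =
  [&& u == 0, v == 0, b != 0 & c / b \in B].
Proof.
apply/imsetP/and4P => [[[b' s]]|[/eqP-> /eqP-> nzb Bs]].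
  rewrite !inE /= => /andP[nzb Bs] [-> -> -> ->].
  by rewrite eqxx nzb mulrC mulKf.
by exists (b, c / b); rewrite ?inE /= ?nzb // mulrC divfK.
Qed.

Lemma qdisc_form81 u v b c :
  qdisc (form81 ((u, v), (b, c))) = u * v * c - b * (u ^+ 2 + v ^+ 2) :> F.
Proof. by rewrite /qdisc !mxE /=; ring. Qed.

Lemma mem_degenerate81 u v b c :
  (((u, v), (b, c)) \in degenerate81) =
  ((u, v) != (0, 0)) && (qdisc (form81 ((u, v), (b, c))) == 0).
Proof.
rewrite qdisc_form81; apply/imsetP/andP => [[[[u' v'] k]]|[nz /eqP disc0]].
  rewrite !inE /= andbT => nz [-> -> -> ->]; split=> //.
  by apply/eqP; ring.
(* The multiplier is read off b when u v != 0. Otherwise exactly one of u, v is zero, so u^2 + v^2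
   is nonzero and c gives the multiplier. *)
have [uv0|nzuv] := eqVneq (u * v) 0; last first.
  exists ((u, v), b / (u * v)); rewrite ?inE ?nz //=.
  rewrite divfK //; congr (_, (_, _)); apply: (mulIf nzuv).
  rewrite mulrAC divfK // mulrC; apply/eqP.
  by rewrite -subr_eq0 disc0.
have nzs : u ^+ 2 + v ^+ 2 != 0.
  move/eqP: uv0 nz; rewrite mulf_eq0 xpair_eqE.
  by case/orP=> /eqP->; rewrite expr0n ?(add0r, addr0) expf_eq0 eqxx ?andbT.
exists ((u, v), c / (u ^+ 2 + v ^+ 2)); rewrite ?inE ?nz //=.
rewrite divfK // uv0 mulr0; congr (_, (_, _)).
move/eqP: disc0; rewrite uv0 mul0r sub0r oppr_eq0 mulf_eq0 (negPf nzs) orbF.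
by move/eqP.
Qed.

(** The missing X^2 term forces l_0 = 0, and the equal coefficients of Y^2 and Z^2 force l_2 = l_1
    or l_2 = -l_1. Conversely, s = 2e with e = 1 or -1 gives b (Y + e Z)^2. *)
Lemma double_form81 t :
  double_line (form81 t) = (t \in pencil [set 2; -2]).
Proof.
case: t => -[u v] [b c]; rewrite mem_pencil !inE.
apply/existsP/and4P => [[k /existsP[l /and3P[nzk nzl /eqP/matrixP eq_t]]]|].
  have := eq_t 0 0; rewrite !mxE /= => /esym/eqP.
  rewrite !mulf_eq0 (negPf nzk) orbb /= => /eqP l0.
  have := eq_t 0 1; have := eq_t 0 2; have := eq_t 1 1; have := eq_t 1 2.
  have := eq_t 2 2; rewrite !mxE /= l0 !(mul0r, mulr0, addr0).
  move=> b22 -> b11 -> ->; rewrite !eqxx.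
  have nzl1 : l 0 1 != 0.
    apply: contraNneq nzl => l1; move: b22; rewrite b11 l1 !mulr0 => /esym/eqP.
    rewrite !mulf_eq0 (negPf nzk) orbb /= => /eqP l2.
    by apply/eqP/rowP; elim/ord3P; rewrite mxE.
  have nzb : b != 0 by rewrite b11 !mulf_neq0.
  rewrite nzb; split=> //; move: b22; rewrite {1}b11 => /(mulfI nzk)/eqP.
  rewrite eq_sym -!expr2 eqf_sqr b11 => /orP[]/eqP->; apply/orP; [left|right];
    by apply/eqP; field; rewrite nzl1.
case=> /eqP-> /eqP-> nzb.
have make (e : F) : e ^+ 2 = 1 -> c / b == 2 * e ->
    [exists k, exists l, [&& k != 0, l != 0 &
      form81 ((0, 0), (b, c)) == k *: lin_mul l l]].
  move=> e2 /eqP s_e; apply/existsP; exists b.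
  apply/existsP; exists (row3 0 1 e); rewrite nzb /=; apply/andP; split.
    by apply/eqP => /rowP/(_ 1)/eqP; rewrite !mxE /= oner_eq0.
  apply/eqP/qform_ext; rewrite ?form81_is_qform ?is_qformZ
    ?lin_mul_is_qform // !mxE /=
    ?(mul0r, mulr0, mul1r, mulr1, addr0) //.
    by rewrite -mulr2n -mulr_natl -s_e mulrC divfK.
  by rewrite -expr2 e2 mulr1.
by case/orP=> s2; apply/existsP; [apply: (make 1) | apply: (make (-1))];
  rewrite ?expr1n ?sqrrN ?mulrN ?mulr1 ?expr1n.
Qed.

(** One factor l is free of X. If the other involves X, the form is degenerate with (u, v) != 0. If
    not, it is a binary form in Y and Z: either c Y Z, or b (Y + r Z)(Y + Z / r) with r != 1/r. *)
Lemma real_form81 t : t != 0 ->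
  real_line_pair (form81 t) =
  [|| t \in degenerate81, t \in pencil split_trace1
    | t \in [set ((0, 0), (0, c)) | c in [set~ 0]]].
Proof.
case: t => -[u v] [b c] nzt; rewrite mem_pencil mem_degenerate81 qdisc_form81.
apply/existsP/or3P => [[l /existsP[m]]|].
  (* The coefficient of X^2 is l_0 m_0 = 0, and the factors may be exchanged. *)
  wlog l0 : l m / l 0 0 = 0.
    move=> IH /andP[nlm /eqP eq_t]; have /matrixP/(_ 0 0) := eq_t.
    rewrite !mxE /= => /esym/eqP; rewrite mulf_eq0 => /orP[]/eqP => [l0|m0].
      by apply: (IH l m); rewrite // nlm eq_t eqxx.
    apply: (IH m l) => //; rewrite lin_mulC -eq_t eqxx andbT.
    have /non_proportionalP[i [k minor]] := nlm; apply/non_proportionalP.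
    by exists k, i; rewrite mulrC [X in _ != X]mulrC.
  case/andP=> /non_proportionalP nlm /eqP/matrixP eq_t.
  have := eq_t 0 1; have := eq_t 0 2; have := eq_t 1 1; have := eq_t 1 2.
  have := eq_t 2 2; rewrite !mxE /= l0 !(mul0r, mulr0, add0r).
  move=> b22 def_c b11 -> ->.
  have nzl : (l 0 1 != 0) || (l 0 2 != 0).
    rewrite -negb_and; apply/andP => -[/eqP l1 /eqP l2].
    case: nlm => i [k]; suff -> : l = 0 by rewrite !mxE !mul0r eqxx.
    by apply/rowP; elim/ord3P; rewrite !mxE.
  have [m0|nzm0] := eqVneq (m 0 0) 0; last first.
    apply: Or31; rewrite xpair_eqE !mulf_eq0 (negPf nzm0) !orbF negb_and nzl.
    apply/eqP.
    transitivity (m 0 0 ^+ 2 * ((l 0 1 * m 0 1 - b) * l 0 2 ^+ 2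
      + (l 0 2 * m 0 2 - b) * l 0 1 ^+ 2)); first by rewrite def_c; ring.
    by rewrite -b11 -b22 subrr !mul0r addr0 mulr0.
  rewrite m0 !mulr0; have [b0|nzb] := eqVneq b 0.
    apply: Or33; apply/imsetP; exists c; rewrite ?b0 // !inE.
    apply: contraNneq nzt => c0; move: (eq_t 0 1) (eq_t 0 2).
    by rewrite !mxE /= l0 m0 !(mul0r, mulr0, add0r) b0 c0 => -> ->.
  apply: Or32; rewrite eqxx /=.
  have [nzl1 nzm1] : l 0 1 != 0 /\ m 0 1 != 0.
    by apply/andP; rewrite -negb_or -mulf_eq0 -b11.
  have [nzl2 nzm2] : l 0 2 != 0 /\ m 0 2 != 0.
    by apply/andP; rewrite -negb_or -mulf_eq0 -b22.
  have def_b1 : l 0 1 / l 0 2 = m 0 2 / m 0 1.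
    by apply/eqP; rewrite eqr_div // -b11 b22 mulrC.
  (* Since l_1 m_1 = l_2 m_2, the ratio m_2 / m_1 is the inverse of r = l_2 / l_1, and c / b is
     their sum. If r = 1/r, then m is a multiple of l. *)
  apply/imsetP; exists (l 0 2 / l 0 1); last first.
    by rewrite /addV invf_div {1}def_b1 def_c b11; field; rewrite nzl1 nzm1.
  rewrite inE mulf_neq0 ?invr_eq0 //= invf_div; apply/negP => /eqP eq_l.
  case: nlm => i [k /eqP]; apply.
  have m1 : m 0 1 = m 0 1 / l 0 1 * l 0 1 by rewrite divfK.
  have m2 : m 0 2 = m 0 1 / l 0 1 * l 0 2.
    by rewrite mulrAC -mulrA eq_l def_b1 mulrC divfK.
  have def_m r : m 0 r = m 0 1 / l 0 1 * l 0 r.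
    by elim/ord3P: r; rewrite // m0 l0 mulr0.
  by rewrite (def_m i) (def_m k); ring.
case.
- case/andP=> nz_uv /eqP disc0.
  (* The cofactor of u Y + v Z is X + m1 Y + m2 Z. When u or v is zero, the discriminant forces b =
     0. *)
  have [m1 [m2 [b11 b22 c12]]] :
      exists m1, exists m2, [/\ b = u * m1, b = v * m2 & c = u * m2 + v * m1].
    have [u0|nzu] := eqVneq u 0; [|have [v0|nzv] := eqVneq v 0].
    - have nzv : v != 0 by apply: contraNneq nz_uv => ->; rewrite u0.
      exists (c / v), 0; rewrite u0 !(mul0r, mulr0, add0r) mulrC divfK //.
      move/eqP: disc0; rewrite u0 !mul0r expr0n !add0r oppr_eq0 mulf_eq0.
      by rewrite expf_eq0 /= (negPf nzv) orbF => /eqP->.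
    - exists 0, (c / u); rewrite v0 !(mul0r, mulr0, addr0) mulrC divfK //.
      move/eqP: disc0; rewrite v0 mulr0 mul0r expr0n addr0 add0r oppr_eq0.
      by rewrite mulf_eq0 expf_eq0 /= (negPf nzu) orbF => /eqP->.
    exists (b / u), (b / v); split; [by field | by field |].
    apply: (mulfI nzu); apply: (mulfI nzv); apply/eqP; rewrite -subr_eq0.
    by apply/eqP; rewrite -disc0; field; rewrite nzu.
  exists (row3 0 u v); apply/existsP; exists (row3 1 m1 m2); apply/andP; split.
    apply/non_proportionalP; exists 0.
    have [u0|nzu] := eqVneq u 0; last first.
      by exists 1; rewrite !mxE /= mul0r mulr1 eq_sym.
    exists 2; rewrite !mxE /= mul0r mulr1 eq_sym.
    by apply: contraNneq nz_uv => ->; rewrite u0.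
  apply/eqP/qform_ext; rewrite ?form81_is_qform ?lin_mul_is_qform // !mxE /=
    ?(mul0r, mulr0, mulr1, add0r) //.
- case/and4P=> /eqP-> /eqP-> nzb /imsetP[r].
  rewrite inE => /andP[nzr neq_r] s_r.
  have def_c : c = b * (r + r^-1) by rewrite -[r + _]s_r mulrC divfK.
  exists (row3 0 b (b * r)); apply/existsP; exists (row3 0 1 r^-1).
  apply/andP; split.
    apply/non_proportionalP; exists 1, 2; rewrite !mxE /= mulr1.
    by rewrite (inj_eq (mulfI nzb)) eq_sym.
  apply/eqP/qform_ext; rewrite ?form81_is_qform ?lin_mul_is_qform // !mxE /=
    ?(mul0r, mulr0, mulr1, add0r) //.
    by rewrite def_c; ring.
  by rewrite mulfK.
- case/imsetP=> d; rewrite !inE => nzd [-> -> -> ->].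
exists (row3 0 d 0); apply/existsP; exists (row3 0 0 1); apply/andP; split.
  by apply/non_proportionalP; exists 1, 2; rewrite !mxE /= mulr1 mul0r.
apply/eqP/qform_ext; rewrite ?form81_is_qform ?lin_mul_is_qform // !mxE /=
    ?(mul0r, mulr0, mulr1, add0r, addr0) //.
Qed.

(** As before l_0 = 0. Equality of the Y^2 and Z^2 coefficients says that w = l_2 / l_1 has norm 1,
    so s = w + w^q = w + 1/w. If also s = r + 1/r with r in F, then w is r or 1/r, so w^q = w and l
    is proportional to its conjugate. The converse takes w from [norm1_addV]. *)
Lemma imaginary_form81 (Fq2 : finFieldType) (iota : {rmorphism F -> Fq2}) t :
    #|Fq2| = (#|F| ^ 2)%N ->
  imaginary_line_pair iota (form81 t) = (t \in pencil (~: trace1)).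
Proof.
move=> hFq2; case: t => -[u v] [b c]; rewrite mem_pencil inE.
apply/existsP/and4P => [[k /existsP[l /and3P[nzk nl /eqP/matrixP eq_t]]]|].
  have nzik : iota k != 0 by rewrite fmorph_eq0.
  have q_gt0 : (0 < #|F|)%N by apply: ltnW; apply: finNzRing_gt1.
  have expq_eq0 x : (x ^+ #|F| == 0 :> Fq2) = (x == 0).
    by rewrite expf_eq0 q_gt0.
  have := eq_t 0 0; rewrite !mxE /= rmorph0 => /esym/eqP.
  rewrite !mulf_eq0 (negPf nzik) expq_eq0 orbb /= => /eqP l0.
  have l0q : l 0 0 ^+ #|F| = 0 by apply/eqP; rewrite expq_eq0 l0.
  have := eq_t 0 1; have := eq_t 0 2; have := eq_t 1 1; have := eq_t 1 2.
  have := eq_t 2 2; rewrite !mxE /= l0q l0 !(mul0r, mulr0, addr0).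
  move=> b22 def_c b11 /eqP; rewrite fmorph_eq0 => -> /eqP.
  rewrite fmorph_eq0 => ->.
  have nzl1 : l 0 1 != 0.
    apply: contraTneq nl => l1; move: b22; rewrite b11 l1 !(mul0r, mulr0).
    move/esym/eqP; rewrite !mulf_eq0 (negPf nzik) expq_eq0 orbb /= => /eqP l2.
    apply/non_proportionalP => -[i [j]].
    suff -> : l = 0 by rewrite !mxE !mul0r eqxx.
    by apply/rowP; elim/ord3P; rewrite mxE.
  have nzb : b != 0.
    by rewrite -(fmorph_eq0 iota) b11 !mulf_neq0 // expq_eq0.
  split=> //; apply/imsetP => -[r]; rewrite !inE => nzr s_r.
  have nzir : iota r != 0 by rewrite fmorph_eq0.
  pose w := l 0 2 / l 0 1.
  have wq : w ^+ #|F| = l 0 2 ^+ #|F| / l 0 1 ^+ #|F| by rewrite expr_div_n.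
  have nzl1q : l 0 1 ^+ #|F| != 0 by rewrite expq_eq0.
  have nzl2 : l 0 2 != 0.
    apply: contraNneq nzb => l2; rewrite -(fmorph_eq0 iota) b22 l2.
    by rewrite mul0r mulr0.
  have nzw : w != 0 by rewrite mulf_neq0 ?invr_eq0.
  have w1 : w * w ^+ #|F| = 1.
    rewrite wq /w mulrACA -invfM; apply: (mulIf (x := l 0 1 * l 0 1 ^+ #|F|)).
      by rewrite mulf_neq0.
    rewrite divfK ?mulf_neq0 // mul1r; apply: (mulfI nzik).
    by rewrite -b11 -b22.
  have wV : w^-1 = w ^+ #|F| by apply: (mulfI nzw); rewrite w1 mulfV.
  have : w + w^-1 == iota r + (iota r)^-1.
    rewrite -fmorphV -rmorphD -[r + _]s_r fmorph_div def_c b11 wV wq /w.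
    by apply/eqP; field; rewrite nzl1q nzik nzl1.
  rewrite addV_eq // => w_in.
  have wqw : w ^+ #|F| = w.
    by case/orP: w_in => /eqP->; rewrite -?fmorphV (frob_fix iota).
  have l2 : l 0 2 = w * l 0 1 by rewrite divfK.
  have l2q : l 0 2 ^+ #|F| = w * l 0 1 ^+ #|F| by rewrite l2 exprMn wqw.
  have /non_proportionalP[i [j]] := nl; rewrite !mxE.
  by elim/ord3P: i; elim/ord3P: j;
    rewrite ?l0q ?l0 ?l2q ?l2 ?(mulr0, mul0r) ?eqxx //;
    rewrite mulrCA mulrA ?eqxx // -mulrA mulrCA eqxx.
case=> /eqP-> /eqP-> nzb no_trace.
have [|w [nzw wq wV wqn]] := norm1_addV iota (s := c / b) hFq2.
  move=> r nzr; apply: contraNneq no_trace => <-.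
  by apply: imset_f; rewrite !inE.
exists b; apply/existsP; exists (row3 0 1 w); apply/and3P; split=> //.
  by apply/non_proportionalP; exists 1, 2; rewrite !mxE /= expr1n mul1r mulr1.
have q_gt0 : (0 < #|F|)%N by apply: ltnW; apply: finNzRing_gt1.
have q0 : 0 ^+ #|F| = 0 :> Fq2 by rewrite expr0n gtn_eqF.
apply/eqP/qform_ext; rewrite ?is_qformZ ?lin_mul_is_qform //
  ?is_qform_map ?form81_is_qform // !mxE /=
  ?expr1n ?q0 ?rmorph0 ?(mul0r, mulr0, mul1r, mulr1, addr0) //.
  by rewrite wq addrC wV -rmorphM mulrC divfK.
by rewrite wq mulfV ?mulr1.
Qed.

(** * Counting the forms in each class *)

Lemma pencil_neq0 B t : t \in pencil B -> t != 0.
Proof.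
case/imsetP=> x; rewrite !inE => /andP[nzx _] ->; apply: contraNneq nzx.
by move/(congr1 (fun t' => t'.2.1)) => /= ->.
Qed.

Lemma degenerate81_neq0 t : t \in degenerate81 -> t != 0.
Proof.
case/imsetP=> x; rewrite !inE => /andP[nzx _] ->; apply: contraNneq nzx.
by move/(congr1 fst) => /= ->.
Qed.

Lemma card_pencil B : #|pencil B| = (#|F|.-1 * #|B|)%N.
Proof.
rewrite card_in_imset => [|[b s] [b' s']]; first by rewrite cardsX cardsC1.
by rewrite !inE /= => /andP[nzb _] _ [<- /(mulfI nzb) <-].
Qed.

Lemma card_degenerate81 : #|degenerate81| = ((#|F| ^ 2).-1 * #|F|)%N.
Proof.
rewrite card_in_imset => [|[[u v] k] [[u' v'] k']].
  by rewrite cardsX cardsC1 cardsT card_prod mulnn.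
rewrite !inE /= !andbT => nz_uv _ [<- <- eq_uv eq_s]; congr (_, _).
(* The multiplier is recovered from u v or, when that vanishes, from u^2 + v^2. *)
have [uv0|nzuv] := eqVneq (u * v) 0; last exact: (mulIf nzuv).
apply: (mulIf _ eq_s); move/eqP: uv0 nz_uv; rewrite mulf_eq0 xpair_eqE.
by case/orP=> /eqP->; rewrite expr0n ?(add0r, addr0) expf_eq0 eqxx ?andbT.
Qed.

Lemma card_double81 :
  #|[set t : (F * F) * (F * F) | (t != 0) && double_line (form81 t)]|
  = (#|F|.-1 * #|[set (2 : F); -2]%R|)%N.
Proof.
rewrite -card_pencil; apply: eq_card => t; rewrite inE double_form81.
exact/andb_idl/pencil_neq0.
Qed.

Lemma card_imaginary81 (Fq2 : finFieldType) (iota : {rmorphism F -> Fq2}) :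
    #|Fq2| = (#|F| ^ 2)%N ->
  #|[set t : (F * F) * (F * F) |
      (t != 0) && imaginary_line_pair iota (form81 t)]|
  = (#|F|.-1 * #|~: trace1|)%N.
Proof.
move=> hFq2; rewrite -card_pencil; apply: eq_card => t.
rewrite inE imaginary_form81 //.
exact/andb_idl/pencil_neq0.
Qed.

(** The three families are disjoint, of sizes q (q^2 - 1), (q - 1) #|split_trace1| and q - 1. *)
Lemma card_real81 :
  #|[set t : (F * F) * (F * F) | (t != 0) && real_line_pair (form81 t)]|
  = (#|F|.-1 * (#|F| ^ 2 + #|F| + 1 + #|split_trace1|))%N.
Proof.
pose X0 : {set (F * F) * (F * F)} := [set ((0, 0), (0, c)) | c in [set~ 0]].
have cardX0 : #|X0| = #|F|.-1.
  by rewrite card_imset ?cardsC1 // => c c' [].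
have X0_neq0 t : t \in X0 -> t != 0.
  case/imsetP=> c; rewrite !inE => nzc ->; apply: contraNneq nzc.
  by move/(congr1 (fun t' => t'.2.2)) => /= ->.
have -> : [set t : (F * F) * (F * F) | (t != 0) && real_line_pair (form81 t)]
    = degenerate81 :|: (pencil split_trace1 :|: X0).
  apply/setP => t; rewrite !in_setU inE; apply/andP/or3P => [[nzt]|].
    by rewrite real_form81 // => /or3P.
  move=> t_in; have nzt : t != 0.
    by case: t_in => [/degenerate81_neq0|/pencil_neq0|/X0_neq0].
  by split; rewrite // real_form81 //; apply/or3P.
rewrite !cardsU card_degenerate81 card_pencil cardX0.
have -> : pencil split_trace1 :&: X0 = set0.
  apply/setP => -[[u v] [b c]]; rewrite inE mem_pencil [RHS]inE.
  apply/andP => -[/and4P[_ _ nzb _] /imsetP[d _ [_ _ b0 _]]].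
  by rewrite b0 eqxx in nzb.
have -> : degenerate81 :&: (pencil split_trace1 :|: X0) = set0.
  apply/setP => -[[u v] [b c]]; rewrite inE mem_degenerate81 [RHS]inE.
  apply/andP => -[/andP[/eqP nz_uv _]]; rewrite inE mem_pencil.
  case/orP=> [/and4P[/eqP u0 /eqP v0 _ _]|/imsetP[d _ [u0 v0 _ _]]];
    by apply: nz_uv; rewrite u0 v0.
rewrite !cards0 !subn0; have := finNzRing_gt1 F.
case: #|F| => // q _; have -> : ((q.+1 ^ 2).-1 = q * q.+2)%N by lia.
by rewrite /=; nia.
Qed.

(** From all q^4 parameters one removes the q (q^2 - 1) degenerate ones and the q^2 with u = v = 0,
    which form [O] and include t = 0. *)
Lemma card_nonsingular81 :
  #|[set t : (F * F) * (F * F) | (t != 0) && nonsingular_conic (form81 t)]|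
  = (#|F|.-1 * (#|F| ^ 3 - #|F|))%N.
Proof.
pose O : {set (F * F) * (F * F)} := setX [set (0, 0)] setT.
have -> : [set t : (F * F) * (F * F) | (t != 0) && nonsingular_conic (form81 t)]
    = ~: (degenerate81 :|: O).
  apply/setP => -[[u v] [b c]]; rewrite !inE mem_degenerate81 /= andbT.
  rewrite negb_or negb_and negbK /nonsingular_conic.
  have [[-> ->]|nz_uv] := eqVneq (u, v) (0, 0).
    by rewrite qdisc_form81 !mul0r expr0n addr0 mulr0 subr0 eqxx !andbF.
  rewrite /= andbT; apply: andb_idl => _; apply: contraNneq nz_uv.
  by move/(congr1 fst) => /= ->.
have disj : degenerate81 :&: O = set0.
  apply/setP => -[[u v] [b c]]; rewrite !inE mem_degenerate81 /= andbT.
  by rewrite andbAC andNb.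
have := cardsC (degenerate81 :|: O).
rewrite cardsU disj cards0 subn0 card_degenerate81 cardsX cards1 cardsT.
rewrite !card_prod; have := finNzRing_gt1 F.
case: #|F| => // q _; have -> : ((q.+1 ^ 2).-1 = q * q.+2)%N by lia.
have -> : (q.+1 ^ 3 - q.+1 = q * q.+1 * q.+2)%N by rewrite !expnS expn0; nia.
by move=> cardC; apply: (addnI (etrans cardC _)); rewrite -pred_Sn; ring.
Qed.

Lemma card_pm2 : #|[set (2 : F); -2]%R| = (odd #|F|).+1.
Proof.
rewrite cards2 -addr_eq0 odd_card_finField.
by rewrite (_ : 2 + 2 = 2 * 2) ?mulf_eq0 ?orbb //; ring.
Qed.

Lemma eq_invr_pm1 (x : F) : x != 0 -> (x == x^-1) = (x \in [set 1; -1]).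
Proof.
by move=> nzx; rewrite -(inj_eq (mulfI nzx)) mulfV // -expr2 sqrf_eq1 !inE.
Qed.

(** On F without 0, 1 and -1 the map x + 1/x is two-to-one; 1 and -1 coincide exactly when q is
    even. *)
Lemma card_split_trace1 : #|F| = (2 * #|split_trace1| + (odd #|F|).+2)%N.
Proof.
pose S := [set x : F | (x != 0) && (x != x^-1)].
have -> : (2 * #|split_trace1|)%N = #|S|.
  rewrite mulnC -(card_imset_fibers (f := addV)) // => x.
  (* Writing 2 as (x != 1/x).+1 turns it into the cardinal of the fibre {x, 1/x}. *)
  rewrite inE => /andP[nzx neq_x]; rewrite -[2%N]/(true.+1) -neq_x -cards2.
  apply: eq_card => y; rewrite !inE; apply/idP/idP => [/andP[/andP[nzy _]]|].
    by rewrite addV_eq.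
  case/orP=> /eqP->; rewrite ?invr_eq0 nzx ?invrK ?neq_x ?eqxx //.
    by rewrite eq_sym neq_x /addV invrK addrC eqxx.
have S1 : 0 \notin [set (1 : F); -1].
  by rewrite !inE ![0 == _]eq_sym oppr_eq0 oner_eq0.
have -> : S = ~: (0 |: [set 1; -1]).
  apply/setP => x; rewrite in_setC in_setU in_set1 inE negb_or.
  by have [//|nzx] := eqVneq x 0; rewrite eq_invr_pm1.
have := cardsC (0 |: [set (1 : F); -1]); rewrite cardsU1 S1 cards2.
rewrite -addr_eq0 -[1 + 1]/2 -odd_card_finField => /esym cardC.
by apply: etrans cardC _; rewrite addnC.
Qed.

(** The fixed points 1 and -1 of inversion add the values 2 and -2 to [split_trace1]. The parity of
    q then cancels between #|F| and the size of {2, -2}. *)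
Lemma card_trace1C : #|~: trace1| = (#|split_trace1|.+1)%N.
Proof.
have trace1E : trace1 = split_trace1 :|: [set 2; -2].
  have -> : [set 2; -2] = addV @: [set 1; -1].
    by rewrite imsetU !imset_set1 /addV invr1 invrN1; congr [set _; _]; ring.
  rewrite -imsetU /trace1; set S := _ :|: _; suff -> : [set~ 0] = S by [].
  apply/setP => x.
  rewrite in_setU !inE; have [->|nzx] := eqVneq x 0.
    by rewrite ![0 == _]eq_sym oppr_eq0 oner_eq0.
  by rewrite eq_invr_pm1 // !inE orNb.
have disj : split_trace1 :&: [set 2; -2] = set0.
  apply/setP => s; rewrite inE [RHS]inE; apply/andP => -[/imsetP[x + ->]].
  rewrite !inE => /andP[nzx /negP neq_x] x2; apply: neq_x.
  rewrite eq_invr_pm1 // !inE; case/orP: x2 => x2; apply/orP; [left|right].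
    have := addV_eq nzx (oner_neq0 F); rewrite invr1 orbb => <-.
    by rewrite -[1 + 1]/2.
  have nzN1 : -1 != 0 :> F by rewrite oppr_eq0 oner_eq0.
  have := addV_eq nzx nzN1; rewrite invrN1 orbb => <-.
  by rewrite -opprD.
have := cardsC trace1; rewrite {1}trace1E cardsU disj cards0 subn0 card_pm2.
move=> cardC; have := etrans cardC card_split_trace1.
by move: (nat_of_bool _) => e; lia.
Qed.

Lemma card_hyperplanes81 (C : pred 'M[F]_3) A n : A \in unitmx ->
    (forall c a, is_qform a -> c != 0 -> C a -> C (c *: a)) ->
    (forall A a, A \in unitmx -> is_qform a -> C a -> C (subst_form A a)) ->
    #|[set t : (F * F) * (F * F) | (t != 0) && C (form81 t)]|
      = (#|F|.-1 * n)%N ->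
  #|[set H in hyperplanes_of C | act_line A (line81 F) \subset H]| = n.
Proof.
move=> uA CZ CA; rewrite (card_hyperplanes_of uA CZ CA) mulnC => /eqP.
by rewrite eqn_pmul2l -?subn1 ?subn_gt0 ?finNzRing_gt1 // => /eqP.
Qed.

End Classes.

Theorem lemma4p4 (F Fq2 : finFieldType) (iota : {rmorphism F -> Fq2})
    (hFq2 : #|Fq2| = (#|F| ^ 2)%N)
    (L : {set point F}) (hL : L \in o81 F) :
  let q : rat := #|F|%:R in
  let od : seq rat := [seq n%:R | n <- OD4 iota L] in
  (~~ odd #|F| ->
     od = [:: 1; q ^+ 2 + 3 / 2 * q; q / 2; q ^+ 3 - q]) /\
  (odd #|F| ->
     od = [:: 2; q ^+ 2 + (3 * q - 1) / 2; (q - 1) / 2; q ^+ 3 - q]).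
Proof.
have [A uA ->] := imsetP hL.
rewrite /OD4 /= /H1 /H2r /H2i /H3; rewrite inE in uA.
rewrite (card_hyperplanes81 uA (@double_lineZ F) (@double_line_subst F)
  (card_double81 F)).
rewrite (card_hyperplanes81 uA (@real_line_pairZ F) (@real_line_pair_subst F)
  (card_real81 F)).
rewrite (card_hyperplanes81 uA (@imaginary_line_pairZ F Fq2 iota)
  (@imaginary_line_pair_subst F Fq2 iota) (card_imaginary81 iota hFq2)).
rewrite (card_hyperplanes81 uA (@nonsingular_conicZ F)
  (@nonsingular_conic_subst F) (card_nonsingular81 F)).
(* The subtraction q^3 - q is truncated, so casting it to rationals requires q <= q^3. *)
rewrite card_pm2 card_trace1C natrB ?natrX; last first.
  by rewrite -{1}(expn1 #|F|) leq_exp2l ?finNzRing_gt1.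
(* With k = #|split_trace1|, q is 2k + 2 or 2k + 3 according to parity, and all four entries become
   expressions in k. *)
have q_eq := card_split_trace1 F; move: #|split_trace1 F| q_eq => k q_eq.
have {}q_eq : (#|F|%:R : rat) = 2 * k%:R + (odd #|F|).+2%:R.
  by rewrite {1}q_eq natrD natrM.
rewrite -[k.+1]addn1 !natrD natrX.
split=> [/negPf | ] odd_q; rewrite odd_q in q_eq *; congr [:: _; _; _; _].
all: by rewrite q_eq /=; field.
Qed.
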